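(* Let $X$ be a locally compact Hausdorff space and let $A$ be a $C^{*}$-algebra. (1) If $X$ is pseudocompact, then $R(f):=\{f(x):x\in X\}$ is compact for each $f\in C^{b}(X,A)$, and $C^{b}(X)\otimes A=C^{b}(X,A)$ (that is, the natural inclusion $\iota_{1}:C^{b}(X)\otimes A\hookrightarrow C^{b}(X,A)$ is an isomorphism). (2) Conversely, if $A$ is not finite dimensional, then $C^{b}(X)\otimes A=C^{b}(X,A)$ holds only if $X$ is pseudocompact. (3) If $A$ is finite dimensional, then $C^{b}(X)\otimes A=C^{b}(X,A)$ always holds.
   Context: A space $X$ is called pseudocompact if every continuous (scalar-valued) function on $X$ is bounded. $C^{b}(X,A)$ denotes the $C^{*}$-algebra of all bounded continuous functions $X\to A$ (with $A$ carrying its norm topology), with pointwise operations and the supremum norm; $C^{b}(X):=C^{b}(X,\mathbb{C})$. Elements of the algebraic tensor product $C^{b}(X)\odot A$ are viewed as functions in $C^{b}(X,A)$ via $(\sum_i f_i\otimes a_i)(x)=\sum_i f_i(x)a_i$. The supremum norm restricts to a $C^{*}$-norm on $C^{b}(X)\odot A$, and $C^{b}(X)\otimes A$ denotes the completion, identified with the norm closure of $C^{b}(X)\odot A$ in $C^{b}(X,A)$; $\iota_{1}$ is the resulting inclusion. *)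

(* Defs.v *)
From HB Require Import structures.
From mathcomp Require Import all_boot all_order all_algebra.
From mathcomp Require Import complex.
From mathcomp Require Import all_classical all_reals all_analysis.
From mathcomp Require Import ring.

Set Implicit Arguments.
Unset Strict Implicit.
Unset Printing Implicit Defensive.

Import Order.TTheory GRing.Theory Num.Theory.
Import numFieldNormedType.Exports.
Local Open Scope classical_set_scope.
Local Open Scope ring_scope.

(* C*-algebras are not assumed unital, hence the product cannot be inherited
   from the (unital) ring structures of the library. *)
HB.mixin Record isCStarAlgebra (R : realType) A
    & CompleteNormedModule R[i] A := {
  cmul : A -> A -> A ;
  cadj : A -> A ;
  cmulA : associative cmul ;
  cmulDl : left_distributive cmul +%R ;
  cmulDr : right_distributive cmul +%R ;
  cmulZl : forall (k : R[i]) a b, cmul (k *: a) b = k *: cmul a b ;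
  cmulZr : forall (k : R[i]) a b, cmul a (k *: b) = k *: cmul a b ;
  cadjK : involutive cadj ;
  cadjD : {morph cadj : a b / a + b} ;
  cadjZ : forall (k : R[i]) a, cadj (k *: a) = k^* *: cadj a ;
  cadjM : forall a b, cadj (cmul a b) = cmul (cadj b) (cadj a) ;
  cnormM : forall a b, `|cmul a b| <= `|a| * `|b| ;
  cnorm_adj : forall a, `|cmul (cadj a) a| = `|a| ^+ 2
}.

#[short(type="cstarAlgType")]
HB.structure Definition CStarAlgebra (R : realType) :=
  {A of isCStarAlgebra R A & CompleteNormedModule R[i] A}.

Definition finite_dimensional (K : fieldType) (V : lmodType K) :=
  exists (n : nat) (e : 'I_n -> V),
    forall v : V, exists c : 'I_n -> K, v = \sum_(i < n) c i *: e i.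

Definition pseudocompact (R : realType) (X : topologicalType) :=
  forall f : X -> R[i]^o, continuous f -> bounded_fun f.

Section BoundedContinuous.
Context {R : realType} (X : topologicalType) (V : normedModType R[i]).

Definition bcont : {pred X -> V} :=
  fun f => `[< continuous f /\ bounded_fun f >].

Record Cb := MkCb { Cb_val :> X -> V ; _ : Cb_val \in bcont }.

HB.instance Definition _ := [isSub for Cb_val].
HB.instance Definition _ := [Choice of Cb by <:].

Lemma bcontP (f : X -> V) :
  reflect (continuous f /\ exists M : R, forall x, `|f x| <= M%:C%C)
          (f \in bcont).
Proof.
apply: (iffP (asboolP _)) => -[cf]; last first.
  move=> [M fM]; split=> //; exists M%:C%C; split; first exact/complex_realP/ex_intro.
  by move=> N /ltW MN x _ /=; exact: le_trans (fM x) MN.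
move=> [M [/complex_realP[k ->] fM]]; split=> //; exists (k + 1) => x.
by apply: fM => //; rewrite ltcR ltrDl.
Qed.

Lemma bcont_submod_closed : submod_closed bcont.
Proof.
split.
  apply/bcontP; split; first exact: cst_continuous.
  by exists 0 => x; rewrite normr0.
move=> k f g /bcontP[cf [M fM]] /bcontP[cg [N gN]]; apply/bcontP; split.
  by move=> x; apply: cvgD; [apply: cvgZl_tmp; exact: cf|exact: cg].
have /complex_realP[K kK] := normr_real k.
exists (K * M + N) => x; apply: (le_trans (ler_normD _ _)).
have -> : (K * M + N)%:C%C = `|k| * M%:C%C + N%:C%C :> R[i].
  by rewrite kK [RHS]/GRing.add/= !mul0r !mulr0 !subr0 !addr0.
by apply: lerD => //; rewrite normrZ ler_wpM2l.
Qed.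

HB.instance Definition _ :=
  GRing.isSubmodClosed.Build R[i] (X -> V) bcont bcont_submod_closed.
HB.instance Definition _ := [SubChoice_isSubLmodule of Cb by <:].

Lemma Cb_continuous (f : Cb) : continuous f.
Proof. by have /bcontP[] := valP f. Qed.

(* Norms take their values in R[i], so the supremum is that of their real
   parts; it is 0 when X is empty. *)
Definition Cb_norm (f : Cb) : R[i] :=
  (sup (range (fun x => complex.Re `|f x|)))%:C%C.

Lemma Cb_norm_ge (f : Cb) x : `|f x| <= Cb_norm f.
Proof.
have /bcontP[_ [M fM]] := valP f.
rewrite -[leLHS]RRe_real ?normr_real// lecR; apply: ub_le_sup; last by exists x.
by exists M => _ [y _ <-]; rewrite -lecR RRe_real ?normr_real.
Qed.

Lemma Cb_norm_le (f : Cb) (M : R[i]) :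
  0 <= M -> (forall x, `|f x| <= M) -> Cb_norm f <= M.
Proof.
move=> M0 fM; rewrite /Cb_norm -(RRe_real (ger0_real M0)) lecR.
have [/set0P[y Sy]|/negPn/eqP ->] :=
    boolP (range (fun x => complex.Re `|f x|) != set0); last first.
  by rewrite sup0 -lecR RRe_real ?ger0_real.
apply: ge_sup; first by exists y.
by move=> _ [x _ <-]; rewrite -lecR !RRe_real ?normr_real ?ger0_real.
Qed.

Lemma Cb_norm_ge0 (f : Cb) : 0 <= Cb_norm f.
Proof.
have [[x _]|X0] := pselect (exists x : X, True).
  exact: le_trans (Cb_norm_ge f x).
rewrite /Cb_norm; have -> : range (fun x => complex.Re `|f x|) = set0.
  by rewrite -subset0 => r [x _ _]; apply: X0; exists x.
by rewrite sup0.
Qed.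

Let Cb_normD (f g : Cb) : Cb_norm (f + g) <= Cb_norm f + Cb_norm g.
Proof.
apply: Cb_norm_le => [|x]; first by rewrite addr_ge0 ?Cb_norm_ge0.
by rewrite (le_trans (ler_normD _ _))// lerD ?Cb_norm_ge.
Qed.

Let Cb_normZ_le (k : R[i]) (f : Cb) : Cb_norm (k *: f) <= `|k| * Cb_norm f.
Proof.
apply: Cb_norm_le => [|x]; first by rewrite mulr_ge0 ?Cb_norm_ge0.
by rewrite normrZ ler_wpM2l ?Cb_norm_ge.
Qed.

Let Cb_normZ (k : R[i]) (f : Cb) : Cb_norm (k *: f) = `|k| * Cb_norm f.
Proof.
apply/le_anti; rewrite Cb_normZ_le/=.
have [->|k0] := eqVneq k 0; first by rewrite normr0 mul0r Cb_norm_ge0.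
rewrite -ler_pdivlMl ?normr_gt0// -normfV.
by have := Cb_normZ_le k^-1 (k *: f); rewrite scalerA mulVf// scale1r.
Qed.

Let Cb_norm_eq0 (f : Cb) : Cb_norm f = 0 -> f = 0.
Proof.
move=> f0; apply/val_inj/funext => x; apply/eqP.
by rewrite -normr_le0 -f0 Cb_norm_ge.
Qed.

HB.instance Definition _ :=
  Lmodule_isNormed.Build R[i] Cb Cb_normD Cb_normZ Cb_norm_eq0.

End BoundedContinuous.

Section Complete.
Context {R : realType} (X : topologicalType) (V : completeNormedModType R[i]).

Let Cb_near (F : set_system (Cb X V)) (l : X -> V) :
  ProperFilter F -> cauchy F -> (forall x, (fun f : Cb X V => f x) @ F --> l x) ->
  forall e : R[i], 0 < e -> F [set f : Cb X V | forall x, `|f x - l x| <= e].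
Proof.
move=> FF Fc Fl e e0; have e3 : 0 < e / 3%:R by rewrite divr_gt0.
have [f0 Ff0] := (cauchyP F).1 Fc _ e3.
have f0near : F [set f : Cb X V | forall x, `|f0 x - f x| <= e / 3%:R].
  move: Ff0; apply: filterS => f; rewrite -ball_normE /= => /ltW f0f x.
  exact: le_trans (Cb_norm_ge (f0 - f) x) f0f.
have f0l x : `|f0 x - l x| <= e / 3%:R + e / 3%:R.
  have /cvgrPdist_le/(_ _ e3) Flx := Fl x; have := filter_ex (filterI f0near Flx).
  move=> [f [/(_ x) h1]]; rewrite /= distrC => h2.
  by rewrite -(subrK (f x) (f0 x)) -addrA (le_trans (ler_normD _ _))// lerD.
move: f0near; apply: filterS => f f0f x.
rewrite -(subrK (f0 x) (f x)) -addrA (le_trans (ler_normD _ _))//.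
have -> : e = e / 3%:R + (e / 3%:R + e / 3%:R) by field.
by rewrite lerD// distrC.
Qed.

Let Cb_complete (F : set_system (Cb X V)) :
  ProperFilter F -> cauchy F -> cvg F.
Proof.
move=> FF Fc.
pose l x := lim ((fun f : Cb X V => f x) @ F).
have Fx x : (fun f : Cb X V => f x) @ F --> l x.
  apply/cauchy_cvgP/cauchyP => e e0.
  have [f0 Ff0] := (cauchyP F).1 Fc _ e0; exists (f0 x).
  change (F [set f : Cb X V | ball (f0 x) e (f x)]).
  move: Ff0; apply: filterS => f; rewrite -!ball_normE /= => f0f.
  exact: le_lt_trans (Cb_norm_ge (f0 - f) x) f0f.
have nearl := Cb_near FF Fc Fx.
have lb : l \in @bcont R X V.
  apply/bcontP; split.
    move=> x; apply/cvgrPdist_le => e e0; have e3 : 0 < e / 3%:R by rewrite divr_gt0.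
    have [f fl] := filter_ex (nearl _ e3).
    have /cvgrPdist_le/(_ _ e3) := @Cb_continuous _ _ _ f x.
    apply: filterS => y fxy.
    have -> : l x - l y = - (f x - l x) + ((f x - f y) + (f y - l y)).
      by rewrite opprB !addrA !subrK.
    rewrite (le_trans (ler_normD _ _))// normrN.
    have -> : e = e / 3%:R + (e / 3%:R + e / 3%:R) by field.
    by rewrite lerD// (le_trans (ler_normD _ _))// lerD.
  have [f fl] := filter_ex (nearl 1 ltr01).
  have /bcontP[_ [M fM]] := valP f; exists (M + 1) => x.
  have -> : l x = f x - (f x - l x) by rewrite opprB addrC subrK.
  rewrite (le_trans (ler_normB _ _))//.
  have -> : (M + 1)%:C%C = M%:C%C + 1 :> R[i] by rewrite [RHS]/GRing.add/= addr0.
  by apply: lerD; [exact: fM|exact: fl].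
apply/cvg_ex; exists (MkCb lb : Cb X V); apply/cvgrPdist_le => e e0.
move: (nearl e e0); apply: filterS => f fl.
by apply: Cb_norm_le => [|x]; [exact: ltW|rewrite distrC; exact: fl].
Qed.

HB.instance Definition _ := Uniform_isComplete.Build (Cb X V) Cb_complete.

End Complete.

Section Pointwise.
Context {R : realType} (X : topologicalType) (A : cstarAlgType R).
Implicit Types f g : Cb X A.

Let cmulBl (a b c : A) : cmul (a - b) c = cmul a c - cmul b c.
Proof. by rewrite -scaleN1r cmulDl cmulZl scaleN1r. Qed.

Let cmulBr (a b c : A) : cmul a (b - c) = cmul a b - cmul a c.
Proof. by rewrite -scaleN1r cmulDr cmulZr scaleN1r. Qed.

Let cadjB (a b : A) : cadj (a - b) = cadj a - cadj b.
Proof. by rewrite -scaleN1r cadjD cadjZ rmorphN1 scaleN1r. Qed.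

Let norm_cadj_le (a : A) : `|a| <= `|cadj a|.
Proof.
have [->|a0] := eqVneq a 0; first by rewrite normr0.
rewrite -(@ler_pM2r _ `|a|) ?normr_gt0// -expr2 -cnorm_adj.
exact: cnormM.
Qed.

Lemma norm_cadj (a : A) : `|cadj a| = `|a|.
Proof.
by apply/le_anti; rewrite norm_cadj_le -{2}(cadjK a) norm_cadj_le.
Qed.

Let cvg_sum_mul (K : numFieldType) (T : Type) (F : set_system T)
    (FF : Filter F) (s t u v : T -> K^o) (a b c d : K^o) :
  s @ F --> a -> t @ F --> b -> u @ F --> c -> v @ F --> d ->
  (fun y => s y * t y + u y * v y : K^o) @ F --> (a * b + c * d : K^o).
Proof. by move=> sa tb uc vd; apply: cvgD; exact: cvgM. Qed.

Let bcont_mul f g : (fun x => cmul (f x) (g x)) \in @bcont R X A.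
Proof.
apply/bcontP; split; last first.
  have /bcontP[_ [M fM]] := valP f; have /bcontP[_ [N gN]] := valP g.
  exists (M * N) => x; apply: (le_trans (cnormM _ _)).
  have -> : (M * N)%:C%C = M%:C%C * N%:C%C :> R[i].
    by rewrite [RHS]/GRing.mul/= !mul0r !mulr0 !subr0 !addr0.
  by apply: ler_pM; [| |exact: fM|exact: gN].
move=> x; have cg := @Cb_continuous _ _ _ g x.
apply/cvgrPdist_le => e e0.
have dist_cvg (h : Cb X A) :
    `|h x - h y| @[y --> x] --> (`|h x - h x| : R[i]^o).
  apply: (@cvg_norm R[i] A); apply: (@cvgB R[i] A); first exact: cvg_cst.
  exact: Cb_continuous.
have [nf ng] := (dist_cvg f, dist_cvg g).
have ng' : `|g y| @[y --> x] --> (`|g x| : R[i]^o).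
  by apply: (@cvg_norm R[i] A); exact: cg.
have nf' : cst `|f x| @ nbhs x --> (`|f x| : R[i]^o).
  exact: (@cvg_cst R[i]^o).
have := @cvg_sum_mul R[i] X (nbhs x) (nbhs_filter x) _ _ _ _ _ _ _ _ nf ng' nf' ng.
rewrite !subrr normr0 mul0r mulr0 addr0 => /cvgrPdist_le/(_ _ e0).
apply: filterS => y; rewrite [cst _ _]/= sub0r normrN ger0_norm ?addr_ge0 ?mulr_ge0//.
apply: le_trans.
have -> : cmul (f x) (g x) - cmul (f y) (g y) =
    cmul (f x - f y) (g y) + cmul (f x) (g x - g y).
  by rewrite cmulBl cmulBr [RHS]addrC addrA subrK.
by rewrite (le_trans (ler_normD _ _))// lerD ?cnormM.
Qed.

Let bcont_adj f : (fun x => cadj (f x)) \in @bcont R X A.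
Proof.
apply/bcontP; split; last first.
  by have /bcontP[_ [M fM]] := valP f; exists M => x; rewrite norm_cadj; exact: fM.
move=> x; apply/cvgrPdist_le => e e0.
have /cvgrPdist_le/(_ _ e0) := @Cb_continuous _ _ _ f x.
by apply: filterS => y; rewrite -cadjB norm_cadj.
Qed.

Definition Cb_mul f g : Cb X A := MkCb (bcont_mul f g).
Definition Cb_adj f : Cb X A := MkCb (bcont_adj f).

Let Cb_ext f g : f =1 g -> f = g.
Proof. by move=> fg; exact/val_inj/funext. Qed.

Let Cb_mulA : associative Cb_mul.
Proof. by move=> f g h; apply: Cb_ext => x /=; rewrite cmulA. Qed.

Let Cb_mulDl : left_distributive Cb_mul +%R.
Proof. by move=> f g h; apply: Cb_ext => x /=; rewrite cmulDl. Qed.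

Let Cb_mulDr : right_distributive Cb_mul +%R.
Proof. by move=> f g h; apply: Cb_ext => x /=; rewrite cmulDr. Qed.

Let Cb_mulZl (k : R[i]) f g : Cb_mul (k *: f) g = k *: Cb_mul f g.
Proof. by apply: Cb_ext => x /=; rewrite cmulZl. Qed.

Let Cb_mulZr (k : R[i]) f g : Cb_mul f (k *: g) = k *: Cb_mul f g.
Proof. by apply: Cb_ext => x /=; rewrite cmulZr. Qed.

Let Cb_adjK : involutive Cb_adj.
Proof. by move=> f; apply: Cb_ext => x /=; rewrite cadjK. Qed.

Let Cb_adjD : {morph Cb_adj : f g / f + g}.
Proof. by move=> f g; apply: Cb_ext => x /=; rewrite cadjD. Qed.

Let Cb_adjZ (k : R[i]) f : Cb_adj (k *: f) = k^* *: Cb_adj f.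
Proof. by apply: Cb_ext => x /=; rewrite cadjZ. Qed.

Let Cb_adjM f g : Cb_adj (Cb_mul f g) = Cb_mul (Cb_adj g) (Cb_adj f).
Proof. by apply: Cb_ext => x /=; rewrite cadjM. Qed.

Let Cb_normM f g : `|Cb_mul f g| <= `|f| * `|g|.
Proof.
apply: Cb_norm_le => [|x]; first by rewrite mulr_ge0.
by rewrite (le_trans (cnormM _ _))// ler_pM// Cb_norm_ge.
Qed.

Let Cb_normadj f : `|Cb_mul (Cb_adj f) f| = `|f| ^+ 2.
Proof.
apply/le_anti/andP; split.
  apply: Cb_norm_le => [|x]; first by rewrite exprn_ge0.
  by rewrite cnorm_adj ler_pXn2r ?nnegrE// Cb_norm_ge.
rewrite -[leRHS]sqrtCK ler_pXn2r ?nnegrE ?sqrtC_ge0//.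
apply: Cb_norm_le => [|x]; first by rewrite sqrtC_ge0.
rewrite -(@ler_pXn2r _ 2) ?nnegrE ?sqrtC_ge0// sqrtCK -cnorm_adj.
exact: Cb_norm_ge (Cb_mul (Cb_adj f) f) x.
Qed.

HB.instance Definition _ := isCStarAlgebra.Build R (Cb X A)
  Cb_mulA Cb_mulDl Cb_mulDr Cb_mulZl Cb_mulZr
  Cb_adjK Cb_adjD Cb_adjZ Cb_adjM Cb_normM Cb_normadj.

End Pointwise.

Section AlgebraicTensor.
Context {R : realType} (X : topologicalType) (A : cstarAlgType R).

(* The algebraic tensor product Cb(X) (.) A, through its embedding
   sum_i f_i (x) a_i |-> (x |-> sum_i f_i(x) a_i) into Cb(X, A). *)
Definition Cb_algtensor : set (Cb X A) :=
  [set g | exists (n : nat) (f : 'I_n -> Cb X R[i]^o) (a : 'I_n -> A),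
     forall x, g x = \sum_(i < n) f i x *: a i].

(* The closure is taken for the supremum norm. *)
Definition Cb_tensor : set (Cb X A) := closure Cb_algtensor.

End AlgebraicTensor.

Arguments Cb_algtensor {R} X A.
Arguments Cb_tensor {R} X A.

(* Main.v *)
(* Call a subset of a normed space totally bounded when it has finite nets of
   every mesh. A bounded continuous f : X -> A lies in the closure of
   Cb(X) (.) A exactly when f(X) is totally bounded: a partition of unity
   subordinate to a finite cover of f(X) by small balls approximates f, and
   conversely an element of Cb(X) (.) A has a bounded range in a finite
   dimensional space.
   If X is pseudocompact every f(X) is totally bounded, since otherwise disjoint
   bumps around an infinite separated subset of f(X), scaled by 1, 2, 3, ...,
   pull back to an unbounded continuous function on X; and f(X) is closed, since
   otherwise x |-> 1 / |f x - a| is unbounded for a limit point a.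
   If X is not pseudocompact and A is infinite dimensional, the same bumps
   around a separated sequence of values of an unbounded function, scaled by a
   separated sequence of the unit ball of A (Riesz), give f in Cb(X, A)
   whose range is not totally bounded. *)
Require Import Defs.
From mathcomp Require Import all_boot all_order all_algebra.
From mathcomp Require Import complex.
From mathcomp Require Import all_classical all_reals all_analysis.

Set Implicit Arguments.
Unset Strict Implicit.
Unset Printing Implicit Defensive.

Import Order.TTheory GRing.Theory Num.Theory.
Import numFieldNormedType.Exports.
Local Open Scope classical_set_scope.
Local Open Scope ring_scope.

(** * Totally bounded sets, separated sequences and compactness *)

Section TotallyBounded.
Context {K : numFieldType} {V : normedModType K}.
Implicit Types S T : set V.

Definition totally_bounded S := forall e : K, 0 < e ->
  exists s : seq V, forall v, S v -> exists2 y, y \in s & `|y - v| < e.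

Lemma totally_bounded_sub S T :
  S `<=` T -> totally_bounded T -> totally_bounded S.
Proof. by move=> ST Tb e /Tb[s sT]; exists s => v /ST/sT. Qed.

Lemma totally_bounded_bounded S :
  totally_bounded S -> exists M : K, forall v, S v -> `|v| <= M.
Proof.
move=> /(_ 1 ltr01)[s sS]; exists (1 + \sum_(y <- s) `|y|) => v /sS[y ys yv].
rewrite -(subrK y v) (le_trans (ler_normD _ _))// lerD//.
  by rewrite distrC ltW.
by rewrite (big_rem y)//= lerDl sumr_ge0.
Qed.

Lemma totally_bounded_approx S :
  (forall e : K, 0 < e -> exists2 T, totally_bounded T &
    forall v, S v -> exists2 w, T w & `|w - v| < e) -> totally_bounded S.
Proof.
move=> ST e e0; have e2 : 0 < e / 2 by rewrite divr_gt0.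
have [T /(_ _ e2)[s sT] Tv] := ST _ e2.
exists s => v /Tv[w /sT[y ys yw] wv]; exists y => //.
by rewrite -(subrKA w) (le_lt_trans (ler_normD _ _))// [ltRHS]splitr ltrD.
Qed.

Lemma compact_totally_bounded S : compact S -> totally_bounded S.
Proof.
rewrite compact_cover => cS e e0.
have [|v Sv|D _ SD] := cS V S (fun y => ball y e).
- by move=> y _; exact: ball_open.
- by exists v => //; exact: ballxx.
exists (finmap.enum_fset D) => v /SD[y /= yD]; rewrite -ball_normE => yv.
by exists y.
Qed.

(** Greedy choice: for some mesh [e] no finite list is a net, so the points already chosen always
    leave a point of [S] at distance at least [e] from all of them. [L n] lists the first [n]
    choices. *)
Lemma not_totally_bounded_separated S : ~ totally_bounded S ->
  exists2 e : K, 0 < e & exists2 y : nat -> V, forall k, S (y k) &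
    forall i j, i != j -> e <= `|y i - y j|.
Proof.
move=> /existsNP[e /not_implyP[e0 /forallNP sS]]; exists e => //.
have pick (s : seq V) : exists v, S v /\ forall y, y \in s -> e <= `|y - v|.
  have /existsNP[v /not_implyP[Sv sv]] := sS s; exists v; split => // y ys.
  rewrite real_leNgt ?normr_real ?gtr0_real//; apply/negP => yv; apply: sv.
  by exists y.
have {pick} [p pP] := choice pick.
pose L := fix L n := if n is n'.+1 then p (L n') :: L n' else [::].
exists (p \o L) => [k|]; first by have [] := pP (L k).
have lt_sep i j : (i < j)%N -> e <= `|p (L i) - p (L j)|.
  move=> ij; apply: (pP (L j)).2; elim: j ij => // j IH.
  by rewrite ltnS leq_eqVlt inE => /predU1P[->|/IH ->]; rewrite ?eqxx ?orbT.
by move=> i j; rewrite neq_ltn => /orP[/lt_sep//|/lt_sep]; rewrite distrC.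
Qed.

End TotallyBounded.

(** An ultrafilter containing [S] must contain a ball of every radius, one of those of a finite net;
    hence it is Cauchy and converges, and its limit stays in the closed set [S]. *)
Lemma totally_bounded_closed_compact (K : numFieldType)
    (V : completeNormedModType K) (S : set V) :
  totally_bounded S -> closed S -> compact S.
Proof.
move=> tbS clS; rewrite compact_ultra => F UF FS.
have PF : ProperFilter F := ultra_proper.
have FF : Filter F by exact: filter_filter.
have /cauchy_cvg/cvg_ex[l Fl] : cauchy F.
  apply/cauchyP => e e0; have [s sS] := tbS e e0.
  apply: contrapT => /forallNP nF.
  (* An ultrafilter containing no ball of radius [e] contains the complement of each, hence the
     intersection of finitely many of them, which misses [S]. *)
  have : F [set v | forall y, y \in s -> ~ ball y e v].
    elim: s {sS} => [|y s IH]; first exact: filterE.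
    have Fy : F (~` ball y e) by have [/nF|] := in_ultra_setVsetC (ball y e) UF.
    apply: filterS (filterI Fy IH) => v [yv sv] z.
    by rewrite inE => /predU1P[->|/sv].
  move=> /(filterI FS)/filter_ex[v [/sS[y ys yv] /(_ y ys)]].
  by rewrite -ball_normE; apply.
exists l; split=> //; apply: clS; rewrite closureEcvg; exists F => //.
by split=> // B SB; apply: filterS FS.
Qed.

(** * Bump functions and gluing along separated centers *)

Section Bump.
Context {K : numFieldType} {V : normedModType K}.
Implicit Types (r : K) (c v : V).

(* The positive part of [1 - |v - c| / r], written so as not to use [Num.max],
   since [K] is only partially ordered. *)
Definition bump r c v : K :=
  (1 - `|v - c| / r + `|1 - `|v - c| / r|) / 2.

Let bump_real r c v : 0 < r -> 1 - `|v - c| / r \is Num.real.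
Proof. by move=> r0; rewrite rpredB ?rpred1// ger0_real// divr_ge0// ltW. Qed.

Lemma bump_center r c : bump r c c = 1.
Proof. by rewrite /bump subrr normr0 mul0r subr0 normr1 mulrDl -splitr. Qed.

Lemma bump_far r c v : 0 < r -> r <= `|v - c| -> bump r c v = 0.
Proof.
move=> r0 rv; rewrite /bump ler0_norm ?subrr ?mul0r//.
by rewrite subr_le0 ler_pdivlMr// mul1r.
Qed.

Lemma bump_near r c v : 0 < r -> `|v - c| < r -> 0 < bump r c v.
Proof.
move=> r0 rv; have t0 : 0 < 1 - `|v - c| / r.
  by rewrite subr_gt0 ltr_pdivrMr// mul1r.
by rewrite /bump gtr0_norm// divr_gt0// addr_gt0.
Qed.

Lemma bump_ge0 r c v : 0 < r -> 0 <= bump r c v.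
Proof.
move=> r0; have [rv|vr] := real_leP (gtr0_real r0) (normr_real (v - c)).
  by rewrite bump_far.
exact/ltW/bump_near.
Qed.

Lemma bump_le1 r c v : 0 < r -> bump r c v <= 1.
Proof.
move=> r0; have [rv|vr] := real_leP (gtr0_real r0) (normr_real (v - c)).
  by rewrite bump_far.
rewrite /bump ger0_norm; last by rewrite subr_ge0 ler_pdivrMr// mul1r ltW.
by rewrite mulrDl -splitr gerBl divr_ge0// ltW.
Qed.

Lemma cvg_bump r c (T : Type) (F : set_system T) (FF : Filter F)
    (f : T -> V) (l : V) : f @ F --> l ->
  (fun x => bump r c (f x) : K^o) @ F --> (bump r c l : K^o).
Proof.
move=> fl.
have cd : (fun x => 1 - `|f x - c| / r : K^o) @ F --> (1 - `|l - c| / r : K^o).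
  apply: (@cvgB K K^o); first exact: cvg_cst.
  apply: (@cvgM K); last exact: (@cvg_cst K^o).
  by apply: (@cvg_norm K V); apply: cvgB => //; exact: cvg_cst.
apply: (@cvgM K); last exact: (@cvg_cst K^o).
by apply: (@cvgD K K^o) => //; exact: (@cvg_norm K K^o).
Qed.

End Bump.

(* Around each point at most one of the bumps centered at the [y k] is nonzero,
   so [F] is the sum over [k] of [bump r (y k) (u x) *: a k]. *)
Lemma glue_separated (K : numFieldType) (V W : normedModType K)
    (X : topologicalType) (u : X -> V) (r : K) (y : nat -> V) (a : nat -> W) :
  continuous u -> 0 < r ->
  (forall i j, i != j -> r *+ 3 <= `|y i - y j|) ->
  exists2 F : X -> W, continuous F &
    (forall x k, u x = y k -> F x = a k) /\
    (forall x, exists k, `|F x| <= `|a k|).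
Proof.
move=> cu r0 ysep.
pose F x := if pselect (exists k, `|u x - y k| < r) is left h
            then bump r (y (projT1 (cid h))) (u x) *: a (projT1 (cid h)) else 0.
(* This hides the choice in [F]: the formula holds for any index [k] whose competitors are far, even
   when [u x] is far from [y k] too, both sides being then 0. *)
have FE x k : (forall j, j != k -> r <= `|u x - y j|) ->
    F x = bump r (y k) (u x) *: a k.
  move=> far; rewrite /F; case: pselect => [h|nh].
    case: cid => /= j xj; have [->//|/far] := eqVneq j k.
    by move=> /(lt_le_trans xj); rewrite ltxx.
  rewrite bump_far ?scale0r//.
  rewrite real_leNgt ?normr_real ?gtr0_real//; apply/negP => xk.
  by apply: nh; exists k.
have near1 x k j : `|u x - y k| < r *+ 2 -> j != k -> r <= `|u x - y j|.
  move=> xk /ysep ykj; rewrite -(lerD2r (r *+ 2)) -mulrS (le_trans ykj)//.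
  rewrite -(subrKA (u x)) (le_trans (ler_normD _ _))//.
  by apply: lerD; [rewrite distrC|exact: ltW].
exists F; last split => [x k xk|x].
- move=> x; have r2 : 0 < r / 2 by rewrite divr_gt0.
  (* One index serves a whole neighborhood of [x]. If a center lies within [3r/2] of [u x], then
     [u x'] is within [2r] of it and [near1] applies; otherwise [u x'] is at least [r] away from
     every center and any index will do. *)
  have [k kP] : exists k, forall x', `|u x - u x'| < r / 2 ->
      forall j, j != k -> r <= `|u x' - y j|.
    have tri x' j : `|u x - u x'| < r / 2 ->
        `|u x - y j| < `|u x' - y j| + r / 2.
      move=> xx'; rewrite [ltRHS]addrC -(subrKA (u x')).
      by rewrite (le_lt_trans (ler_normD _ _))// ltrD2r.
    have [[k xk]|nk] := pselect (exists k, `|u x - y k| < r + r / 2).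
      exists k => x' xx' j; apply: near1; rewrite distrC in xx'.
      rewrite -(subrKA (u x)) (le_lt_trans (ler_normD _ _))//.
      by rewrite (lt_le_trans (ltrD xx' xk))// addrCA -splitr.
    exists 0%N => x' /tri xx' j _; rewrite real_leNgt ?normr_real ?gtr0_real//.
    apply/negP => x'j; apply: nk; exists j.
    by rewrite (lt_trans (xx' j))// ltrD2r.
  have Fx : F x = bump r (y k) (u x) *: a k.
    by apply: FE; apply: kP; rewrite subrr normr0.
  have cF : (fun x' => bump r (y k) (u x') *: a k) @ nbhs x --> F x.
    rewrite Fx; apply: (@cvgZ K W); last exact: cvg_cst.
    by apply: cvg_bump; exact: cu.
  apply: cvg_trans cF; apply: near_eq_cvg.
  have /cvgrPdist_lt/(_ _ r2) := cu x; apply: filterS => x' /kP.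
  by move=> /FE ->.
- rewrite (FE _ k) ?xk ?bump_center ?scale1r// -xk => j.
  by apply: near1; rewrite xk subrr normr0 pmulrn_lgt0.
- have [[k xk]|nk] := pselect (exists k, `|u x - y k| < r); last first.
    by exists 0%N; rewrite /F; case: pselect => //; rewrite normr0.
  exists k; rewrite (FE _ k); last first.
    by move=> j; apply: near1; rewrite (lt_le_trans xk)// mulr2n lerDl ltW.
  by rewrite normrZ ger0_norm ?bump_ge0// ler_piMl// bump_le1.
Qed.

(** * Finite dimensional subspaces and Riesz's lemma *)

Section FiniteSpan.
Context {R : realType}.

Lemma Re_le_norm (z : R[i]) (M : R) : `|z| <= M%:C%C -> `|complex.Re z| <= M.
Proof. by move=> zM; rewrite -lecR (le_trans (normc_ge_Re z)). Qed.

Lemma Im_le_norm (z : R[i]) (M : R) : `|z| <= M%:C%C -> `|complex.Im z| <= M.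
Proof.
move=> zM; rewrite -lecR (le_trans _ zM)// normc_def lecR -sqrtr_sqr.
by rewrite ler_wsqrtr// lerDr sqr_ge0.
Qed.

Lemma cvg_real_complex (T : Type) (F : set_system T) (FF : Filter F)
    (f : T -> R) (l : R) : f @ F --> l ->
  (fun x => (f x)%:C%C : R[i]^o) @ F --> (l%:C%C : R[i]^o).
Proof.
move=> fl; apply/cvgrPdist_lt => e e0.
have eE : e = (complex.Re e)%:C%C by rewrite RRe_real ?gtr0_real.
have e'0 : 0 < complex.Re e by move: e0; rewrite {1}eE ltcR.
have /cvgrPdist_lt/(_ _ e'0) := fl; apply: filterS => x fx.
by rewrite -rmorphB eE normc_def /= expr0n addr0 sqrtr_sqr ltcR.
Qed.

(** A square rather than a disc, so that compactness comes from a product of two real segments. *)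
Definition csquare (M : R) : set R[i]^o :=
  [set z | `|complex.Re z| <= M /\ `|complex.Im z| <= M].

Lemma csquare_compact (M : R) : compact (csquare M).
Proof.
pose g (p : R * R) : R[i]^o := p.1%:C%C + 'i%C * p.2%:C%C.
have -> : csquare M = g @` (`[- M, M] `*` `[- M, M]).
  apply/seteqP; split=> [z [zr zi]|_ [[a b] [/= ha hb] <-]].
    exists (complex.Re z, complex.Im z); last by rewrite /g -complexE.
    by rewrite /= !in_itv/= -!ler_norml.
  by move: ha hb; rewrite /csquare /g /= !in_itv/= -!ler_norml; simpc.
apply: continuous_compact; last by apply: compact_setX; exact: segment_compact.
apply: continuous_subspaceT => p; apply: (@cvgD _ R[i]^o).
  by apply: cvg_real_complex; exact: cvg_fst.
apply: (@cvgM R[i]); first exact: (@cvg_cst R[i]^o).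
by apply: cvg_real_complex; exact: cvg_snd.
Qed.

Context {V : normedModType R[i]}.

Definition fspan n (e : 'I_n -> V) : set V :=
  [set v | exists c : 'I_n -> R[i], v = \sum_(i < n) c i *: e i].

Definition fbox n (e : 'I_n -> V) (M : R) : set V :=
  [set v | exists2 c : 'I_n -> R[i], (forall i, csquare M (c i)) &
    v = \sum_(i < n) c i *: e i].

Lemma fbox_compact n (e : 'I_n -> V) M : compact (fbox e M).
Proof.
elim: n e => [|n IH] e.
  have -> : fbox e M = [set 0]; last exact: compact_set1.
  apply/seteqP; split=> [_ [c _ ->]|_ ->]; first by rewrite big_ord0.
  by exists (fun=> 0) => [[]//|]; rewrite big_ord0.
pose g (p : V * R[i]^o) : V := p.1 + p.2 *: e ord_max.
have -> : fbox e M =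
    g @` (fbox (fun i => e (widen_ord (leqnSn n) i)) M `*` csquare M).
  apply/seteqP; split=> [_ [c cM ->]|_ [[_ k] [/= [c cM ->] kM] <-]].
    exists (\sum_(i < n) c (widen_ord (leqnSn n) i) *:
      e (widen_ord (leqnSn n) i), c ord_max).
      by split=> //=; exists (fun i => c (widen_ord (leqnSn n) i)).
    by rewrite /g /= [RHS]big_ord_recr.
  pose c' (i : 'I_n.+1) := if unlift ord_max i is Some j then c j else k.
  exists c' => [i|].
    by rewrite /c'; case: unlift.
  rewrite big_ord_recr /= /g /c' unlift_none; congr (_ + _).
  apply: eq_bigr => i _; congr (_ *: _).
  have -> : widen_ord (leqnSn n) i = lift ord_max i.
    exact/val_inj/esym/lift_max.
  by rewrite liftK.
apply: continuous_compact; last first.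
  by apply: compact_setX; [exact: IH|exact: csquare_compact].
apply: continuous_subspaceT => p; apply: (@cvgD _ V); first exact: cvg_fst.
by apply: (@cvgZ R[i] V); [exact: cvg_snd|exact: cvg_cst].
Qed.

Lemma fspan_bounded_fbox n (e : 'I_n -> V) (C : R[i]) :
  (forall v, fspan e v -> exists2 c : 'I_n -> R[i],
     v = \sum_(i < n) c i *: e i & forall i, `|c i| <= C * `|v|) ->
  0 <= C ->
  forall M : R[i], exists N : R, forall v, fspan e v -> `|v| <= M -> fbox e N v.
Proof.
(* The order on [R[i]] is partial; if [0 <= M] fails, no norm is below [M]. *)
move=> eC C0 M; have [M0|M0] := pselect (0 <= M); last first.
  by exists 0 => v _ vM; case: M0; exact: le_trans vM.
exists (complex.Re (C * M)) => v /eC[c vE cC] vM; exists c => // i.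
have ciM : `|c i| <= (complex.Re (C * M))%:C%C.
  rewrite RRe_real ?ger0_real ?mulr_ge0//.
  by rewrite (le_trans (cC i))// ler_wpM2l.
by split; [exact: Re_le_norm|exact: Im_le_norm].
Qed.

(** Near a limit point [v], the points of the span have norm at most [|v| + 1], so they lie in one
    compact, hence closed, box, which then contains [v]. *)
Lemma fspan_coef_closed n (e : 'I_n -> V) (C : R[i]) :
  (forall v, fspan e v -> exists2 c : 'I_n -> R[i],
     v = \sum_(i < n) c i *: e i & forall i, `|c i| <= C * `|v|) ->
  0 <= C -> closed (fspan e).
Proof.
move=> eC C0 v clv; have [N eN] := fspan_bounded_fbox eC C0 (`|v| + 1).
have [|||c _ ->] := @compact_closed _ (fbox e N) _ _ v.
- exact: norm_hausdorff.
- exact: fbox_compact.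
- move=> B vB; have [|w [we [vw Bw]]] := clv (ball v 1 `&` B).
    by apply: filterI => //; exact: nbhsx_ballx.
  exists w; split=> //; apply: eN => //; move: vw; rewrite -ball_normE /= => vw.
  rewrite -(subrK v w) addrC (le_trans (ler_normD _ _))// lerD//.
  by rewrite distrC ltW.
by exists c.
Qed.

(** The family [e] may be dependent, so the coefficients are chosen, by induction on [n]. A last
    vector in the span of the others gets coefficient 0; otherwise its positive distance to that
    span, closed by induction, controls its coefficient. *)
Lemma fspan_coef n (e : 'I_n -> V) : exists2 C : R[i], 0 <= C &
  forall v, fspan e v -> exists2 c : 'I_n -> R[i],
    v = \sum_(i < n) c i *: e i & forall i, `|c i| <= C * `|v|.
Proof.
elim: n e => [|n IH] e.
  by exists 0 => // v [c ->]; exists c => // -[].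
pose w i := widen_ord (leqnSn n) i.
have [C C0 eC] := IH (e \o w).
have wE i : w i = lift ord_max i by apply/val_inj/esym/lift_max.
pose ext (c : 'I_n -> R[i]) k (i : 'I_n.+1) :=
  if unlift ord_max i is Some j then c j else k.
have extE c k :
    \sum_(i < n.+1) ext c k i *: e i =
    \sum_(i < n) c i *: e (w i) + k *: e ord_max.
  rewrite big_ord_recr /= /ext unlift_none; congr (_ + _).
  by apply: eq_bigr => i _; rewrite -/(w i) wE liftK.
have split_span v : fspan e v ->
    exists2 u, fspan (e \o w) u & exists k, v = u + k *: e ord_max.
  move=> [c ->]; exists (\sum_(i < n) c (w i) *: e (w i)).
    by exists (c \o w).
  by exists (c ord_max); rewrite big_ord_recr.
have spanZ u k : fspan (e \o w) u -> fspan (e \o w) (k *: u).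
  move=> [c ->]; exists (fun i => k * c i); rewrite scaler_sumr.
  by apply: eq_bigr => i _; rewrite scalerA.
have [emaxs|emax] := pselect (fspan (e \o w) (e ord_max)).
  exists C => // v /split_span[u us [k vE]].
  have /eC[c cE cC] : fspan (e \o w) v.
    have [d dE] := spanZ _ k emaxs; have [c cE] := us.
    exists (fun i => c i + d i); rewrite vE dE cE -big_split.
    by apply: eq_bigr => i _; rewrite scalerDl.
  exists (ext c 0); first by rewrite extE scale0r addr0.
  move=> i; rewrite /ext; case: unlift => [j|]; first exact: cC.
  by rewrite normr0 mulr_ge0.
have [d d0 demax] : exists2 d : R[i], 0 < d &
    forall u, fspan (e \o w) u -> d <= `|e ord_max - u|.
  have /closed_openC : closed (fspan (e \o w)) := fspan_coef_closed eC C0.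
  rewrite openE => /(_ _ emax) /nbhs_ballP[d /= d0 dP].
  exists d => // u us; rewrite real_leNgt ?normr_real ?gtr0_real//.
  by apply/negP => eu; apply: (dP u) us; rewrite -ball_normE.
have dV0 : 0 <= d^-1 by rewrite invr_ge0 ltW.
(* Factoring out [k] leaves the difference of [e ord_max] and a vector of the smaller span, of norm
   at least [d]. *)
have kd k u : fspan (e \o w) u -> `|k| <= d^-1 * `|u + k *: e ord_max|.
  move=> us; have [->|k0] := eqVneq k 0; first by rewrite normr0 mulr_ge0.
  rewrite ler_pdivlMl//.
  have -> : u + k *: e ord_max = k *: (e ord_max - (- k^-1) *: u).
    by rewrite scalerBr scalerA mulrN mulfV// scaleN1r opprK addrC.
  by rewrite normrZ mulrC ler_wpM2l// demax//; exact: spanZ.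
(* The first term bounds the last coefficient [k]; the second bounds the others, since
   [u = v - k *: e ord_max] has norm at most [(1 + d^-1 * |e ord_max|) * |v|]. *)
exists (d^-1 + C * (1 + d^-1 * `|e ord_max|)).
  by rewrite addr_ge0// mulr_ge0// addr_ge0// mulr_ge0.
move=> v /split_span[u us [k vE]]; have [c uE cC] := eC _ us.
exists (ext c k); first by rewrite extE vE; congr (_ + _).
have kv : `|k| <= d^-1 * `|v| by rewrite vE kd.
move=> i; rewrite mulrDl /ext; case: unlift => [j|]; last first.
  by rewrite (le_trans kv)// lerDl !mulr_ge0// addr_ge0// mulr_ge0.
rewrite (le_trans (cC j))// -mulrA -[leLHS]add0r lerD ?mulr_ge0//.
rewrite ler_wpM2l// mulrDl mul1r.
have -> : u = v - k *: e ord_max by rewrite vE addrK.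
rewrite (le_trans (ler_normB _ _))// lerD// normrZ mulrAC.
by rewrite ler_wpM2r.
Qed.

Lemma fspan_closed n (e : 'I_n -> V) : closed (fspan e).
Proof. by have [C C0 eC] := fspan_coef e; exact: fspan_coef_closed eC C0. Qed.

Lemma fspan_totally_bounded n (e : 'I_n -> V) (S : set V) (M : R[i]) :
  S `<=` fspan e -> (forall v, S v -> `|v| <= M) -> totally_bounded S.
Proof.
move=> Se SM; have [C C0 eC] := fspan_coef e.
have [N eN] := fspan_bounded_fbox eC C0 M.
apply: totally_bounded_sub (compact_totally_bounded (@fbox_compact _ e N)).
by move=> v Sv; apply: eN; [exact: Se|exact: SM].
Qed.

(* Riesz's lemma: a net of the unit ball with mesh [1/2] spans a subspace
   that is dense, and closed because finite dimensional. *)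
Lemma totally_bounded_ball_finite_dimensional :
  totally_bounded [set v : V | `|v| <= 1] -> finite_dimensional V.
Proof.
have h0 : 0 < 2^-1 :> R[i] by rewrite invr_gt0.
move=> /(_ _ h0)[s sP]; exists (size s), (fun i => s`_i).
set e := (fun i : 'I_(size s) => s`_i) => v.
(* Each step normalizes the residual [v - w], replaces it by a net point within [1/2], and scales
   back, which halves the error. *)
have halve k : exists2 w, fspan e w & `|v - w| <= 2^-1 ^+ k * `|v|.
  elim: k => [|k [w [c wE] vw]].
    exists 0; last by rewrite subr0 expr0 mul1r.
    by exists (fun=> 0); rewrite big1// => i _; rewrite scale0r.
  have [r0|r0] := eqVneq (v - w) 0.
    by exists w; [exists c|rewrite r0 normr0 mulr_ge0// exprn_ge0// ltW].
  have nr0 : 0 < `|v - w| by rewrite normr_gt0.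
  have [|y ys yr] := sP (`|v - w|^-1 *: (v - w)).
    by rewrite /= normrZ normfV normr_id mulVf// gt_eqF.
  have ys' : (index y s < size s)%N by rewrite index_mem.
  exists (w + `|v - w| *: y).
    exists (fun i => c i + (if i == Ordinal ys' then `|v - w| else 0)).
    under eq_bigr do rewrite scalerDl; rewrite big_split /= -wE; congr (_ + _).
    rewrite (bigD1 (Ordinal ys'))//= eqxx /e /= nth_index// big1 ?addr0//.
    by move=> i /negbTE ->; rewrite scale0r.
  have -> : v - (w + `|v - w| *: y) = `|v - w| *: (`|v - w|^-1 *: (v - w) - y).
    by rewrite scalerBr scalerA mulfV ?gt_eqF// scale1r opprD addrA.
  rewrite normrZ normr_id [X in _ * X]distrC exprS -mulrA [leRHS]mulrC.
  by rewrite ler_pM// ltW.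
suff /fspan_closed : closure (fspan e) v by [].
move=> B /nbhs_ballP[d /= d0 dB].
(* As [k < 2 ^ k], this makes the error [2^-k * |v|] smaller than [d]. The Archimedean bound is
   taken in [R], through the real part. *)
have [k kd] : exists k : nat, `|v| / d < k%:R.
  have vd : `|v| / d = (complex.Re (`|v| / d))%:C%C.
    by rewrite RRe_real// ger0_real// divr_ge0// ltW.
  exists (Num.bound (complex.Re (`|v| / d))).
  rewrite vd -(rmorph_nat (@real_complex R)) ltcR archi_boundP//.
  by rewrite -lecR -vd divr_ge0// ltW.
have [u us vu] := halve k; exists u; split=> //; apply: dB.
rewrite -ball_normE /= (le_lt_trans vu)// exprVn ltr_pdivrMl ?exprn_gt0//.
rewrite ltr_pdivrMr// in kd; rewrite (lt_le_trans kd)// ler_pM2r//.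
by rewrite -natrX ler_nat ltnW// ltn_expl.
Qed.

End FiniteSpan.

(** Pigeonhole: a point within [e / 2] of two terms of the sequence would bring them closer than
    [e], so a finite net of mesh [e / 2] would inject [nat]. *)
Lemma separated_not_totally_bounded (K : numFieldType) (V : normedModType K)
    (S : set V) (e : K) (y : nat -> V) :
  0 < e -> (forall k, S (y k)) -> (forall i j, i != j -> e <= `|y i - y j|) ->
  ~ totally_bounded S.
Proof.
move=> e0 Sy ysep /(_ (e / 2))[|s sS]; first by rewrite divr_gt0.
have [z zP] := choice (fun k => let: ex_intro2 z zs zy := sS _ (Sy k) in
  ex_intro (fun z => z \in s /\ `|z - y k| < e / 2) z (conj zs zy)).
have zinj : injective z.
  move=> i j zij; apply/eqP; apply: contraT => /ysep.
  rewrite real_leNgt ?normr_real ?gtr0_real// -(subrKA (z i)).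
  rewrite (le_lt_trans (ler_normD _ _))// [ltRHS]splitr ltrD//.
    by rewrite distrC (zP i).2.
  by rewrite zij (zP j).2.
have /uniq_leq_size/(_ _) : uniq (map z (iota 0 (size s).+1)).
  by rewrite map_inj_uniq// iota_uniq.
move=> /(_ s); rewrite size_map size_iota ltnn => -/(_ _)/notF; apply.
by move=> _ /mapP[k _ ->]; exact: (zP k).1.
Qed.

(** * Ranges of continuous functions and membership in the tensor product *)

Section Cb_totally_bounded.
Context {R : realType} {X : topologicalType}.

Lemma bcont_le (V : normedModType R[i]) (f : X -> V) (M : R[i]) :
  continuous f -> (forall x, `|f x| <= M) -> f \in @bcont R X V.
Proof.
move=> cf fM; apply/bcontP; split=> //; exists (complex.Re M) => x.
by rewrite RRe_real// ger0_real// (le_trans _ (fM x)).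
Qed.

Lemma pseudocompact_bound (f : X -> R[i]^o) : pseudocompact R X ->
  continuous f -> exists2 M : R, 0 <= M & forall x, `|f x| <= M%:C%C.
Proof.
move=> pX cf; have /bcontP[_ [M fM]] : f \in @bcont R X R[i]^o.
  by apply/asboolP; split=> //; exact: pX.
exists `|M| => // x; apply: le_trans (fM x) _.
by rewrite lecR ler_norm.
Qed.

Lemma pseudocompact_totally_bounded (V : normedModType R[i]) (f : X -> V) :
  pseudocompact R X -> continuous f -> totally_bounded (range f).
Proof.
move=> pX cf; apply: contrapT.
move=> /not_totally_bounded_separated[e e0 [y yf ysep]].
(* Gluing bumps of radius [r] requires centers at distance at least [3r]. *)
have e3 : 0 < e / 3%:R by rewrite divr_gt0.
have [|F cF [Fy _]] :=
    @glue_separated _ V R[i]^o X f _ y (fun k => k%:R) cf e3.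
  move=> i j /ysep; apply: le_trans.
  by rewrite -[leLHS]mulr_natr divfK ?pnatr_eq0.
have [M M0 FM] := pseudocompact_bound pX cF.
have [x _ xy] := yf (Num.bound M).
have := FM x; rewrite (Fy _ _ xy) normr_nat -(rmorph_nat (@real_complex R)).
by rewrite lecR leNgt archi_boundP.
Qed.

Lemma pseudocompact_range_closed (V : normedModType R[i]) (f : X -> V) :
  pseudocompact R X -> continuous f -> closed (range f).
Proof.
move=> pX cf a cla; apply: contrapT => nfa.
have fa x : `|f x - a| != 0.
  by rewrite normr_eq0 subr_eq0; apply/eqP => fxa; apply: nfa; exists x.
have ch : continuous (fun x => `|f x - a|^-1 : R[i]^o).
  move=> x; apply: (@cvgV R[i]) => //; apply: (@cvg_norm R[i] V).
  by apply: cvgB; [exact: cf|exact: cvg_cst].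
have [M M0 hM] := pseudocompact_bound pX ch.
(* Adding 1 keeps the radius [1 / (M + 1)] meaningful when [M = 0], and makes the reciprocal exceed
   [M] strictly. *)
have M1 : 0 < (M + 1)%:C%C :> R[i] by rewrite ltcR ltr_wpDl.
have d0 : 0 < (M + 1)%:C%C^-1 :> R[i] by rewrite invr_gt0.
have [_ [[x _ <-]]] := cla _ (nbhsx_ballx a _ d0).
rewrite -ball_normE /= distrC => xa; have := hM x.
rewrite normfV normr_id => hx.
have fxa : 0 < `|f x - a| by rewrite lt0r fa normr_ge0.
have : (M + 1)%:C%C < `|f x - a|^-1 by rewrite -ltf_pV2 ?invrK// posrE invr_gt0.
by move=> /lt_le_trans/(_ hx); rewrite ltcR gtrDl ltr10.
Qed.

Lemma not_pseudocompact_Cb (V : normedModType R[i]) :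
  ~ finite_dimensional V -> ~ pseudocompact R X ->
  exists f : Cb X V, ~ totally_bounded (range f).
Proof.
move=> infV /existsNP[u /not_implyP[cu ub]].
have [|r r0 [y uy ysep]] := @not_totally_bounded_separated _ R[i]^o (range u).
  move=> /totally_bounded_bounded[M uM]; apply: ub.
  have : u \in @bcont R X R[i]^o.
    by apply: (bcont_le cu) => x; apply: uM; exists x.
  by move=> /asboolP[].
have [|e e0 [a a1 asep]] :=
    @not_totally_bounded_separated _ V [set v | `|v| <= 1].
  by move=> /totally_bounded_ball_finite_dimensional.
have r3 : 0 < r / 3%:R by rewrite divr_gt0.
have [|F cF [Fa Fle]] := @glue_separated _ R[i]^o V X u _ y a cu r3.
  move=> i j /ysep; apply: le_trans.
  by rewrite -[leLHS]mulr_natr divfK ?pnatr_eq0.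
have FC : F \in @bcont R X V.
  by apply: (bcont_le cF) => x; have [k /le_trans] := Fle x; apply; exact: a1.
exists (MkCb FC); apply: separated_not_totally_bounded e0 _ asep => k.
by have [x _ xy] := uy k; exists x => //=; exact: Fa.
Qed.

Variable A : cstarAlgType R.

(* A partition of unity subordinate to a finite cover of the range by small
   balls, pulled back along [f]. *)
Lemma totally_bounded_Cb_tensor (f : Cb X A) :
  totally_bounded (range f) -> Cb_tensor X A f.
Proof.
move=> tbf B /nbhs_ballP[d /= d0 dB].
have d2 : 0 < d / 2 by rewrite divr_gt0.
have [s sP] := tbf _ d2.
pose phi (i : 'I_(size s)) x := bump (d / 2) s`_i (f x).
pose S x := \sum_(i < size s) phi i x.
have phi0 i x : 0 <= phi i x by exact: bump_ge0.
(* Some net point lies within [d / 2] of [f x], and its bump is positive there. *)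
have S0 x : 0 < S x.
  have [|y ys yx] := sP (f x); first by exists x.
  have ys' : (index y s < size s)%N by rewrite index_mem.
  rewrite /S (bigD1 (Ordinal ys'))//= ltr_pwDl ?sumr_ge0// /phi /= nth_index//.
  by rewrite bump_near// distrC.
have cphi i : continuous (phi i : X -> R[i]^o).
  by move=> x; apply: cvg_bump; exact: Cb_continuous.
have cS : continuous (S : X -> R[i]^o).
  apply: continuous_big => //.
  exact: (@pseudometric_normed_Zmodule.add_continuous _ R[i]^o).
have q0 i x : 0 <= phi i x / S x by rewrite divr_ge0// ltW.
have q1 i x : phi i x / S x <= 1.
  by rewrite ler_pdivrMr// mul1r /S (bigD1 i)//= lerDl sumr_ge0.
have sum_q x : \sum_(i < size s) phi i x / S x = 1.
  by rewrite -mulr_suml -/(S x) mulfV// gt_eqF.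
have gC i : (fun x => phi i x / S x : R[i]^o) \in @bcont R X R[i]^o.
  apply: (@bcont_le _ _ 1) => x.
    apply: (@cvgM R[i]); first exact: cphi.
    by apply: (@cvgV R[i]); [rewrite gt_eqF|exact: cS].
  by rewrite (ger0_norm (q0 i x)); exact: q1.
pose g x := \sum_(i < size s) (phi i x / S x) *: s`_i.
have fg x : `|f x - g x| <= d / 2.
  have fE : f x = \sum_(i < size s) (phi i x / S x) *: f x.
    by rewrite -scaler_suml sum_q scale1r.
  have dE : d / 2 = \sum_(i < size s) (phi i x / S x) * (d / 2).
    by rewrite -mulr_suml sum_q mul1r.
  rewrite [in leLHS]fE [leRHS]dE /g -sumrB (le_trans (ler_norm_sum _ _ _))//.
  apply: ler_sum => i _; rewrite -scalerBr normrZ.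
  rewrite ger0_norm//.
  (* A net point at distance at least [d / 2] from [f x] has weight 0, so every term is at most its
     weight times [d / 2]. *)
  have [far|near] := real_leP (gtr0_real d2) (normr_real (f x - s`_i)).
    by rewrite /phi bump_far// !mul0r.
  by rewrite ler_wpM2l// ltW.
have gA : g \in @bcont R X A.
  apply: (@bcont_le _ _ (Cb_norm f + d / 2)).
    apply: continuous_big => [|i _ x].
      exact: (@pseudometric_normed_Zmodule.add_continuous _ A).
    apply: (@cvgZ R[i] A); last exact: cvg_cst.
    by have /bcontP[cg _] := gC i; exact: cg.
  move=> x; rewrite -(subrK (f x) (g x)) addrC (le_trans (ler_normD _ _))//.
  by rewrite lerD ?Cb_norm_ge// distrC.
exists (MkCb gA); split.
  by exists (size s), (fun i => MkCb (gC i)), (fun i => s`_i).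
apply: dB; rewrite -ball_normE /=; apply: (@le_lt_trans _ _ (d / 2)).
  by apply: Cb_norm_le => [|x]; [exact: ltW|exact: fg].
by rewrite ltr_pdivrMr// ltr_pMr// ltr1n.
Qed.

(** Total boundedness of the range passes to uniform limits, which reduces the claim to sums of
    elementary tensors. *)
Lemma Cb_tensor_totally_bounded (f : Cb X A) :
  Cb_tensor X A f -> totally_bounded (range f).
Proof.
move=> tf; apply: totally_bounded_approx => e e0.
have [g [[n [c [a gE]]]]] := tf _ (nbhsx_ballx f _ e0).
rewrite -ball_normE /= => fg; exists (range g).
  apply: (@fspan_totally_bounded _ _ _ a _ (Cb_norm g)) => _ [x _ <-].
    by exists (fun i => c i x); rewrite gE.
  exact: Cb_norm_ge.
move=> _ [x _ <-]; exists (g x); first by exists x.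
by rewrite distrC (le_lt_trans _ fg)//; exact: (Cb_norm_ge (f - g)).
Qed.

End Cb_totally_bounded.

Theorem corollary2 (R : realType) (X : topologicalType) (A : cstarAlgType R) :
  hausdorff_space X -> locally_compact [set: X] ->
  [/\ pseudocompact R X ->
        (forall f : Cb X A, compact (range f)) /\
        Cb_tensor X A = [set: Cb X A],
      ~ finite_dimensional A ->
        Cb_tensor X A = [set: Cb X A] -> pseudocompact R X
    & finite_dimensional A -> Cb_tensor X A = [set: Cb X A]].
Proof.
move=> _ _; split=> [pX|infA tA|[n [e eA]]].
- have tb (f : Cb X A) : totally_bounded (range f).
    by apply: pseudocompact_totally_bounded => //; exact: Cb_continuous.
  split=> [f|].
    apply: totally_bounded_closed_compact (tb f) _.
    apply: (@pseudocompact_range_closed _ _ A _ pX).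
    exact: Cb_continuous.
  by apply/seteqP; split=> // f _; exact: totally_bounded_Cb_tensor.
- apply: contrapT => /(not_pseudocompact_Cb infA)[f]; apply.
  by apply: Cb_tensor_totally_bounded; rewrite tA.
(* Here [e] spans all of [A], so boundedness of [f] alone makes its range totally bounded. *)
- apply/seteqP; split=> // f _; apply: totally_bounded_Cb_tensor.
  apply: (@fspan_totally_bounded _ _ _ e _ (Cb_norm f)) => _ [x _ <-].
    exact: eA.
  exact: Cb_norm_ge.
Qed.
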